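(* Let $\tau$ be an infinite cardinal number, $X$ be a $\tau$-paracompact normal (Hausdorff) space, $A\subset X$ be a closed set, $E$ be a Fréchet space with $d(E)\leq\tau$, and $\Phi:X\leadsto E$ be a convex-valued open relation. Then every continuous selection $g:A\to E$ for $\Phi\upharpoonright A$ can be extended to a continuous selection for $\Phi$.
   Context: All topological spaces are assumed Hausdorff and all vector spaces are real. $d(E)$ denotes the density of $E$ (least cardinality of a dense subset). A space $X$ is $\tau$-paracompact if each open cover of $X$ of cardinality $\leq\tau$ has a locally finite open refinement (covering $X$). A metric $d$ on a vector space $E$ is invariant if $d(u+w,v+w)=d(u,v)$ for all $u,v,w\in E$. A topological vector space is Fréchet if it is locally convex and its topology is generated by a complete invariant metric. For a relation $\Phi\subset X\times Y$, $\Phi(x)=\{y\in Y:\langle x,y\rangle\in\Phi\}$; writing $\Phi:X\leadsto Y$ means that $\Phi(x)\neq\varnothing$ for every $x\in X$. $\Phi$ is open if it is an open subset of $X\times Y$, and convex-valued if each $\Phi(x)$ is convex. A selection for $\Phi:X\leadsto Y$ is a map $f:X\to Y$ with $f(x)\in\Phi(x)$ for every $x\in X$. $\Phi\upharpoonright A$ is the restriction of $\Phi$ to $A$, so a selection for $\Phi\upharpoonright A$ is a map $g:A\to Y$ with $g(x)\in\Phi(x)$ for every $x\in A$. *)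

(* Defs.v *)
From HB Require Import structures.
From mathcomp Require Import all_boot all_order all_algebra.
From mathcomp Require Import all_classical all_reals all_analysis.

Set Implicit Arguments.
Unset Strict Implicit.
Unset Printing Implicit Defensive.

Import Order.TTheory GRing.Theory Num.Theory.
Import numFieldNormedType.Exports.

Local Open Scope classical_set_scope.
Local Open Scope card_scope.
Local Open Scope ring_scope.

(* A cardinal tau is represented by a type T of that cardinality, and
   "of cardinality at most tau" is rendered by [#<= [set: T]]. *)

Section covers.
Context {X : topologicalType}.
Implicit Types U V : set (set X).

Definition open_cover U := U `<=` open /\ \bigcup_(u in U) u = [set: X].

Definition refines V U := forall v, V v -> exists2 u, U u & v `<=` u.

Definition locally_finite V :=
  forall x : X, exists2 W, nbhs x W & finite_set [set v | V v /\ v `&` W !=set0].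

End covers.

Definition tau_paracompact (T : Type) (X : topologicalType) :=
  forall U : set (set X), open_cover U -> U #<= [set: T] ->
    exists V : set (set X), [/\ open_cover V, refines V U & locally_finite V].

(* d(X) <= tau *)
Definition density_le (X : topologicalType) (T : Type) :=
  exists2 D : set X, dense D & D #<= [set: T].

Section metrics.
Context {R : realType}.

Definition is_metric (E : Type) (d : E -> E -> R) :=
  [/\ forall x y, 0 <= d x y,
      forall x y, d x y = 0 <-> x = y,
      forall x y, d x y = d y x
    & forall x y z, d x z <= d x y + d y z].

Definition generates_topology (E : topologicalType) (d : E -> E -> R) :=
  forall (x : E) (U : set E),
    nbhs x U <-> exists2 e : R, 0 < e & [set y | d x y < e] `<=` U.

Definition complete_metric (E : Type) (d : E -> E -> R) :=
  forall u : nat -> E,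
    (forall e : R, 0 < e ->
       exists N : nat, forall m n : nat, (N <= m)%N -> (N <= n)%N ->
         d (u m) (u n) < e) ->
    exists l : E, forall e : R, 0 < e ->
      exists N : nat, forall n : nat, (N <= n)%N -> d (u n) l < e.

Definition invariant_metric (E : zmodType) (d : E -> E -> R) :=
  forall u v w, d (u + w) (v + w) = d u v.

(* Local convexity is part of [tvsType].  The uniform structure bundled in
   [tvsType] is deliberately not used: the library does not require it to be
   the translation-invariant one. *)
Definition frechet_space (E : tvsType R) :=
  exists d : E -> E -> R,
    [/\ is_metric d, generates_topology d, complete_metric d
      & invariant_metric d].

End metrics.

(* Phi(x) is [xsection Phi x]. *)
Section relations.
Context {X Y : Type}.
Implicit Types (Phi : set (X * Y)) (A : set X) (f : X -> Y).

Definition nonempty_valued Phi := forall x, xsection Phi x !=set0.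

Definition selection_on Phi A f := forall x, A x -> xsection Phi x (f x).

Definition selection Phi f := selection_on Phi [set: X] f.

End relations.

Definition convex_valued (R : realType) (X : Type) (E : tvsType R)
    (Phi : set (X * E)) :=
  forall x, convex_set (xsection Phi x).

(* Main.v *)
Require Import Defs.
From HB Require Import structures.
From mathcomp Require Import all_boot all_order all_algebra.
From mathcomp Require Import all_classical all_reals all_analysis.
From mathcomp Require Import ring lra.

Set Implicit Arguments.
Unset Strict Implicit.
Unset Printing Implicit Defensive.

Import Order.TTheory GRing.Theory Num.Theory.
Import numFieldNormedType.Exports.

Local Open Scope classical_set_scope.
Local Open Scope ring_scope.

(** The engine is a selection principle for relations with open fibers
    ([open_fiber_selection]).  Suppose every value [Phi x] is convex and meets
    a fixed set [D] with [#|D| <= tau], and every fiber [{x | e in Phi x}] with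
    [e] in [D] is open.  The fibers then form an open cover of [X] of
    cardinality at most [tau]; by [tau]-paracompactness and normality it has a
    subordinated locally finite partition of unity, and averaging points [e]
    of [D] with these weights gives a continuous selection, since near each
    [x] it is a finite convex combination of points of [Phi x].

    This is used twice.  Applied to the given relation with [D] dense in [E],
    it yields some continuous selection [f1], which ignores [g].  Applied to
    relations of the form
      [x |-> {e in V | x in A -> g x - e in W}]
    with [V], [W] convex open and [0 in W], it approximates a [V]-valued map
    on [A] up to [W] by a [V]-valued continuous map on all of [X].  Iterating
    on the error with convex neighborhoods [V n] of [0] inside the balls of
    radius [2^-n], as in the proof of Tietze's theorem, gives a uniformly
    Cauchy sequence whose limit [h] is a continuous extension of [g] to [X]
    ([frechet_extension]); this is where completeness and the invariance of
    the metric enter.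

    The extension [h] takes values in [Phi] on the open set
    [U = {x | h x in Phi x}], which contains [A].  With a Urysohn function [l]
    equal to [1] on [A] and to [0] off [U], the map [l h + (1 - l) f1] is the
    wanted selection: off [U] it is [f1], and on [U] it is a convex
    combination of two points of [Phi x]. *)

(** * Shrinking point-finite covers of normal spaces *)

(** A property of finitely many indices that holds piecewise along a nonempty
    chain already holds at one member of the chain, the largest of those
    witnessing it.  It makes the union of a chain of partial shrinkings
    cover. *)
Lemma total_on_finite_subset (S : Type) (I : eqType) (F : set (set S))
    (D : set S -> set I) (r : seq I) :
    (forall G H, G `<=` H -> D G `<=` D H) -> total_on F subset ->
    F !=set0 -> [set` r] `<=` \bigcup_(G in F) D G ->
  exists2 G, F G & [set` r] `<=` D G.
Proof.
move=> Dmono Ftot [G0 FG0]; elim: r => [|i r IHr] irF.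
  by exists G0 => // i; rewrite /= in_nil.
have [|G FG rG] := IHr.
  by move=> j jr; apply: irF; rewrite /= inE; apply/orP; right.
have [|H FH Hi] := irF i; first by rewrite /= inE eqxx.
have [GH|HG] := Ftot _ _ FG FH; [exists H => //|exists G => //];
  move=> j; rewrite /= inE => /predU1P[->//|jr].
- exact: Dmono GH _ (rG _ jr).
- exact: Dmono HG _ Hi.
- exact: rG.
Qed.

Lemma normal_shrink (X : topologicalType) (C U : set X) :
    normal_space X -> closed C -> open U -> C `<=` U ->
  exists W, [/\ open W, C `<=` W & closure W `<=` U].
Proof.
move=> normX clC oU CU.
have [|W CW WU] := normX C clC U.
  by move=> x /CU Ux; exact: open_nbhs_nbhs.
exists W°; split; first exact: open_interior.
- by move=> x /CW.
- by apply: subset_trans WU; apply: closure_subset; exact: interior_subset.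
Qed.

(** A partial shrinking is a functional graph [G] of pairs [(v, w)] with
    [closure w] inside [v]; together with the members of [V] not yet shrunk,
    the sets [w] must still cover [X].  Point-finiteness keeps this covering
    condition along chains: were every [v] containing [x] shrunk in the union
    of the chain, they would all be shrunk in one member of it.  In a maximal
    [G] every [v] is shrunk, because the points of [v] that nothing else
    covers form a closed set, around which normality fits a new [w]. *)
Lemma point_finite_shrinking (X : topologicalType) (V : set (set X)) :
    normal_space X -> open_cover V ->
    (forall x, finite_set [set v | V v /\ v x]) ->
  exists s : set X -> set X,
    (forall v, V v -> open (s v) /\ closure (s v) `<=` v) /\
    \bigcup_(v in V) s v = [set: X].
Proof.
move=> normX [oV covV] finV.
pose dom (G : set (set X * set X)) := [set v | exists w, G (v, w)].
pose P (G : set (set X * set X)) :=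
  [/\ forall v w, G (v, w) -> [/\ V v, open w & closure w `<=` v],
      forall v w w', G (v, w) -> G (v, w') -> w = w'
    & forall x, (exists2 p, G p & p.2 x) \/
                exists v, [/\ V v, v x & ~ dom G v]].
have [|G [[GV Gfun Gcov] Gmax]] := @Zorn_bigcup _ P.
  move=> F FP Ftot; split.
  - by move=> v w [G /FP[+ _ _]]; apply.
  - move=> v w w' [G FG Gw] [H FH Hw'].
    have [GH|HG] := Ftot _ _ FG FH.
      by have [_ + _] := FP _ FH; apply; [exact: GH Gw|exact: Hw'].
    by have [_ + _] := FP _ FG; apply; [exact: Gw|exact: HG Hw'].
  - move=> x; apply: contrapT => /not_orP[nx1 nx2].
    have xdom v : V v -> v x -> dom (\bigcup_(G in F) G) v.
      by move=> Vv vx; apply: contrapT => ndom; apply: nx2; exists v.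
    have [v0 Vv0 v0x] : (\bigcup_(v in V) v) x by rewrite covV.
    have [w0 [G0 FG0 _]] := xdom _ Vv0 v0x.
    have /finite_seqP[r rE] := finV x.
    have [||||G FG rG] := @total_on_finite_subset _ _ F dom r.
    + by move=> G H GH v [w Gw]; exists w; exact: GH.
    + exact: Ftot.
    + by exists G0.
    + move=> v; rewrite -rE => -[Vv vx].
      by have [w [G FG Gw]] := xdom _ Vv vx; exists G => //; exists w.
    + have [_ _ /(_ x)[[p Gp px]|[v [Vv vx nGv]]]] := FP _ FG.
        by apply: nx1; exists p => //; exists G.
      by apply: nGv; apply: rG; rewrite -rE.
have domG v : V v -> dom G v.
  move=> Vv; apply: contrapT => nGv.
  (* [N] is what the cover obtained from [G] contains without [v]. *)
  pose N := \bigcup_(p in G) p.2 `|`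
            \bigcup_(u in [set u | [/\ V u, u <> v & ~ dom G u]]) u.
  have oN : open N.
    apply: openU; apply: bigcup_open.
      by move=> [u w] /GV[].
    by move=> u [/oV].
  have [|||w [ow Nw wv]] := @normal_shrink _ (~` N) v normX.
  - exact: open_closedC.
  - exact: oV.
  - move=> x nNx; apply: contrapT => nvx.
    have [[p Gp px]|[u [Vu ux nGu]]] := Gcov x.
      by apply: nNx; left; exists p.
    apply: nNx; right; exists u => //; split => // uv.
    by apply: nvx; rewrite -uv.
  - apply: (Gmax (G `|` [set (v, w)])).
      split; first exact: subsetUl.
      by move=> /(_ (v, w)) Gvw; apply: nGv; exists w; apply: Gvw; right.
    split.
    + by move=> v' w' [/GV//|[-> ->]]; split.
    + move=> v' w1 w2 [G1|[v'E ->]] [G2|[v'E' ->]] //; first exact: Gfun G1 G2.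
      * by exfalso; apply: nGv; exists w1; rewrite -v'E'.
      * by exfalso; apply: nGv; exists w2; rewrite -v'E.
    + move=> x; have [wx|nwx] := pselect (w x).
        by left; exists (v, w) => //; right.
      have [[p Gp px]|[u [Vu uv nGu]] ux] : N x.
      * by apply: contrapT => nNx; exact/nwx/Nw.
      * by left; exists p => //; left.
      * right; exists u; split => // -[w' [Gw'|[uv' _]]] //.
        by apply: nGu; exists w'.
have /choice[s sP] : forall v, exists w, V v -> G (v, w).
  move=> v; have [/domG[w Gw]|nV] := pselect (V v); first by exists w.
  by exists set0.
exists s; split; first by move=> v /[dup] Vv /sP /GV[].
apply/seteqP; split=> // x _.
have [[[v w] Gvw wx]|[v [/domG]]] // := Gcov x.
have [Vv _ _] := GV _ _ Gvw.
by exists v => //; rewrite (Gfun _ _ _ (sP _ Vv) Gvw).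
Qed.

(** * Locally finite partitions of unity *)

Lemma locally_finite_fsum_continuous (X : topologicalType)
    (M : TopologicalNmodule.type) (I : choiceType) (D : set I)
    (f : I -> X -> M) :
    (forall i, D i -> continuous (f i)) ->
    (forall x : X, exists2 W, nbhs x W &
       finite_set [set i | D i /\ exists2 y, W y & f i y != 0]) ->
  continuous (fun x => \sum_(i \in D) f i x).
Proof.
move=> fcont ffin x; have [W Wx Wfin] := ffin x.
set B := [set i | _] in Wfin.
pose r := finmap.enum_fset (fset_set B).
have sumE : {near x, (fun y => \sum_(i <- r) f i y) =1
    (fun y => \sum_(i \in D) f i y)}.
  apply: filterS Wx => y Wy; rewrite -fsbig_finite//; apply: fsbig_widen.
    by move=> i [].
  move=> i [Di nBi] /=; apply: contrapT => /eqP fiy.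
  by apply: nBi; split=> //; exists y.
rewrite /continuous_at -(nbhs_singleton sumE).
apply: cvg_trans (near_eq_cvg sumE) _.
have : forall i, i \in r -> D i.
  by move=> i iB; have := iB; rewrite in_fset_set// inE => -[].
elim: r {sumE} => [_|i r IHr rD].
  under eq_fun do rewrite big_nil; rewrite big_nil; exact: cvg_cst.
under eq_fun do rewrite big_cons; rewrite big_cons.
apply: (@continuous_comp _ _ _ (fun y => (f i y, \sum_(j <- r) f j y))
  (fun z => z.1 + z.2)); last exact: add_continuous.
apply: cvg_pair; first by apply: fcont; apply: rD; rewrite inE eqxx.
by apply: IHr => j jr; apply: rD; rewrite inE jr orbT.
Qed.

Lemma Urysohn_function (R : realType) (X : topologicalType) (A U : set X) :
    normal_space X -> closed A -> open U -> A `<=` U ->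
  exists l : X -> R, [/\ continuous l, forall x, 0 <= l x <= 1,
    forall x, A x -> l x = 1 & forall x, l x != 0 -> U x].
Proof.
move=> normX clA oU AU.
have /(normal_uniform_separator normX (open_closedC oU) clA) :
    ~` U `&` A = set0.
  by apply/seteqP; split => // x [nUx /AU].
move=> /(@uniform_separatorP _ R)[l [lcont l01 l0 l1]]; exists l; split => //.
- by move=> x; have := l01 (l x); rewrite /= in_itv/=; apply; exists x.
- by move=> x Ax; apply: l1; exists x.
- move=> x; apply: contraNP => nUx; apply/eqP; apply: l0.
  by exists x.
Qed.

(** Shrinking the cover first gives each [v] a Urysohn function that is [1] on
    the shrunk set and [0] off [v].  The shrunk sets still cover, so the
    locally finite sum of these functions is positive and can be divided by. *)
Lemma partition_of_unity (R : realType) (X : topologicalType)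
    (V : set (set X)) :
    normal_space X -> open_cover V -> locally_finite V ->
  exists p : set X -> X -> R,
    [/\ forall v, V v -> continuous (p v), forall v x, 0 <= p v x,
        forall v x, V v -> p v x != 0 -> v x
      & forall x, \sum_(v \in V) p v x = 1].
Proof.
move=> normX covV lfV.
have finV x : finite_set [set v | V v /\ v x].
  have [W Wx] := lfV x; apply: sub_finite_set => v [Vv vx]; split => //.
  by exists x; split => //; exact: nbhs_singleton.
have [s [sV scov]] := point_finite_shrinking normX covV finV.
have /choice[l lP] : forall v, exists l : X -> R,
    (forall x, 0 <= l x) /\ (V v -> [/\ continuous l,
      forall x, s v x -> l x = 1 & forall x, l x != 0 -> v x]).
  move=> v; have [Vv|nV] := pselect (V v); last by exists (fun=> 0).
  have [_ sv] := sV v Vv; have [oV _] := covV.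
  have [l [lcont l01 l1 l0]] := @Urysohn_function R _ (closure (s v)) v normX
    (@closed_closure _ _) (oV _ Vv) sv.
  exists l; split => [x|_]; first by have /andP[] := l01 x.
  by split => // x svx; apply: l1; exact: subset_closure.
have l_ge0 v x : 0 <= l v x by have [] := lP v.
pose S x := \sum_(v \in V) l v x.
have Scont : continuous S.
  apply: (@locally_finite_fsum_continuous _ R).
    by move=> v Vv; have [_ /(_ Vv)[]] := lP v.
  move=> x; have [W Wx Wfin] := lfV x; exists W => //.
  apply: sub_finite_set Wfin => v [Vv [y Wy lvy]]; split => //; exists y.
  by split => //; have [_ /(_ Vv)[_ _]] := lP v; apply.
have Sgt0 x : 0 < S x.
  have [v Vv svx] : (\bigcup_(v in V) s v) x by rewrite scov.
  rewrite lt_neqAle fsumr_ge0 ?andbT; last by move=> u _; exact: l_ge0.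
  rewrite eq_sym; apply/eqP => S0.
  have lv1 : l v x = 1 by have [_ /(_ Vv)[_ l1 _]] := lP v; exact: l1.
  have : l v x = 0.
    (* Only the finitely many members of [V] through [x] contribute. *)
    have S0' : \sum_(u \in [set u | V u /\ u x]) l u x = 0.
      rewrite -[RHS]S0; apply: fsbig_widen => [u []//|u [Vu nux] /=].
      apply: contrapT => /eqP lux; apply: nux; split => //.
      by have [_ /(_ Vu)[_ _]] := lP u; apply.
    apply: (pfsumr_eq0 (finV x) _ S0') => //; split => //.
    by have [_] := sV v Vv; apply; exact: subset_closure.
  by rewrite lv1 => /eqP; rewrite oner_eq0.
exists (fun v x => (S x)^-1 * l v x); split.
- move=> v Vv x; apply: cvgM; last by have [_ /(_ Vv)[+ _ _]] := lP v; apply.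
  by apply: cvgV; [rewrite gt_eqF|exact: Scont].
- by move=> v x; rewrite mulr_ge0// invr_ge0 ltW.
- move=> v x Vv; rewrite mulf_eq0 => /norP[_].
  by have [_ /(_ Vv)[_ _]] := lP v; apply.
- by move=> x; rewrite -mulr_fsumr mulVf// gt_eqF.
Qed.

(** * Convex combinations and selections *)

Lemma tvs_cvgZ (R : realType) (E : tvsType R) (X : Type) (F : set_system X)
    {FF : Filter F} (f : X -> R) (g : X -> E) (a : R) (b : E) :
  f @ F --> a -> g @ F --> b -> f x *: g x @[x --> F] --> a *: b.
Proof.
move=> fa gb.
apply: (@continuous2_cvg _ R^o E E F _ f g (fun x y => x *: y)) => //.
exact: (@scale_continuous R E (a, b)).
Qed.

Lemma tvs_cvgD (R : realType) (E : tvsType R) (X : Type) (F : set_system X)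
    {FF : Filter F} (f g : X -> E) (a b : E) :
  f @ F --> a -> g @ F --> b -> f x + g x @[x --> F] --> a + b.
Proof.
move=> fa gb.
apply: (@continuous2_cvg _ E E E F FF f g (fun x y => x + y)) => //.
exact: (@add_continuous E (a, b)).
Qed.

Lemma convex_setP (R : realType) (M : lmodType R) (C : set M) :
  convex_set (C : set (convex_lmodType M)) <->
  forall (t : R) (x y : M), 0 <= t <= 1 -> C x -> C y ->
    C (t *: x + (1 - t) *: y).
Proof.
split=> [cvxC t x y /andP[t0 t1] Cx Cy|cvxC x y t].
  by have := cvxC x y (Itv01 t0 t1); rewrite !inE; apply.
rewrite !inE => Cx Cy; apply: cvxC => //.
by rewrite ge0 le1.
Qed.

(** The induction runs on the normalized statement
    [(\sum w)^-1 *: \sum w e \in C] for a positive total weight, because a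
    tail of the sum no longer has total weight [1]. *)
Lemma convex_set_sum (R : realType) (M : lmodType R) (C : set M)
    (I : eqType) (r : seq I) (w : I -> R) (e : I -> M) :
    convex_set (C : set (convex_lmodType M)) ->
    (forall i, i \in r -> 0 <= w i) ->
    (forall i, i \in r -> w i != 0 -> C (e i)) ->
  \sum_(i <- r) w i = 1 -> C (\sum_(i <- r) w i *: e i).
Proof.
move=> /convex_setP cvxC w_ge0 wC r1.
suff : 0 < \sum_(i <- r) w i ->
    C ((\sum_(i <- r) w i)^-1 *: \sum_(i <- r) w i *: e i).
  by rewrite r1 invr1 scale1r; apply.
elim: r w_ge0 wC {r1} => [|i r IHr] w_ge0 wC; first by rewrite big_nil ltxx.
have ri j : j \in r -> j \in i :: r by rewrite inE orbC => ->.
rewrite !big_cons; set s := \sum_(j <- r) w j; set v := \sum_(j <- r) _.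
have {}IHr : 0 < s -> C (s^-1 *: v).
  by apply: IHr => j /ri; [exact: w_ge0|exact: wC].
have s_ge0 : 0 <= s by rewrite /s big_seq sumr_ge0// => j /ri; exact: w_ge0.
have [wi0|wi_neq0] := eqVneq (w i) 0; first by rewrite wi0 scale0r !add0r.
have Cei : C (e i) by apply: wC; rewrite ?mem_head.
have wi_ge0 : 0 <= w i by apply: w_ge0; rewrite mem_head.
have [s0 _|s_neq0 ws_gt0] := eqVneq s 0.
  have v0 : v = 0.
    move/eqP: s0; rewrite /s big_seq psumr_eq0; last by move=> j /ri/w_ge0.
    move=> /allP w_eq0; apply: big1_seq => j /= jr.
    by have /= := w_eq0 j jr; rewrite jr => /eqP ->; rewrite scale0r.
  by rewrite s0 v0 !addr0 scalerA mulVf// scale1r.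
have -> : (w i + s)^-1 *: (w i *: e i + v) =
    (w i / (w i + s)) *: e i + (1 - w i / (w i + s)) *: (s^-1 *: v).
  rewrite scalerDr !scalerA [_^-1 * w i]mulrC; congr (_ + _ *: _).
  by field; rewrite s_neq0 gt_eqF.
apply: cvxC => //; last by apply: IHr; rewrite lt_neqAle eq_sym s_neq0.
by rewrite divr_ge0 ?(ltW ws_gt0)//= ler_pdivrMr// mul1r lerDl.
Qed.

(** Over an arbitrary index set finiteness comes for free: a sum with infinite
    support is [0] by convention, hence is not [1]. *)
Lemma convex_set_fsum (R : realType) (M : lmodType R) (C : set M)
    (I : choiceType) (D : set I) (w : I -> R) (e : I -> M) :
    convex_set (C : set (convex_lmodType M)) ->
    (forall i, D i -> 0 <= w i) -> (forall i, D i -> w i != 0 -> C (e i)) ->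
  \sum_(i \in D) w i = 1 -> C (\sum_(i \in D) w i *: e i).
Proof.
move=> cvxC w_ge0 wC.
case: finite_supportP => [_|r rD w0 rE].
  by rewrite big_nil => /eqP; rewrite eq_sym oner_eq0.
have wrE : \sum_(i \in D) w i *: e i =
    \sum_(i <- finmap.enum_fset r) w i *: e i.
  rewrite [RHS]fsbig_seq ?finmap.fset_uniq//; apply/esym.
  apply: fsbig_widen => // i [Di nri] /=.
  by rewrite w0 ?scale0r//; exact/negP.
rewrite wrE => r1; apply: convex_set_sum => // i ir.
  exact/w_ge0/rD.
exact/wC/rD.
Qed.

(** The fibers over [D] cover [X], and there are at most [#|T|] of them.  Each
    member [v] of a locally finite refinement lies in the fiber of some [e v];
    a weight [p v x] is nonzero only if [x] is in [v], so that only points of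
    [Phi x] are averaged at [x]. *)
Lemma open_fiber_selection (R : realType) (T : Type) (X : topologicalType)
    (E : tvsType R) (D : set E) (Phi : set (X * E)) :
    normal_space X -> tau_paracompact T X -> (D #<= [set: T])%card ->
    convex_valued Phi -> (forall e, D e -> open [set x | Phi (x, e)]) ->
    (forall x, exists2 e, D e & Phi (x, e)) ->
  exists2 f : X -> E, continuous f & selection Phi f.
Proof.
move=> normX paraX cardD cvxPhi oPhi DPhi.
pose F e := [set x | Phi (x, e)].
have [||V [covV VF lfV]] := paraX [set F e | e in D].
- split; first by move=> _ [e De <-]; exact: oPhi.
  apply/seteqP; split => // x _; have [e De Phixe] := DPhi x.
  by exists (F e) => //; exists e.
- exact: card_le_trans (card_image_le _ _) cardD.
have /choice[e eP] : forall v, exists e, V v -> v `<=` F e.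
  move=> v; have [Vv|nV] := pselect (V v); last by exists 0.
  by have [_ [e De <-] ve] := VF v Vv; exists e.
have [p [pcont p0 pV p1]] := partition_of_unity R normX covV lfV.
exists (fun x => \sum_(v \in V) p v x *: e v).
  apply: locally_finite_fsum_continuous.
    by move=> v Vv x; apply: tvs_cvgZ; [exact: pcont|exact: cvg_cst].
  move=> x; have [W Wx Wfin] := lfV x; exists W => //.
  apply: sub_finite_set Wfin => v [Vv [y Wy pvy]]; split => //; exists y.
  split => //; apply: pV => //; apply: contra_neq pvy => ->.
  by rewrite scale0r.
move=> x _; apply: (convex_set_fsum (cvxPhi x)) => //.
by move=> v Vv pvx; rewrite /xsection /= inE; apply: (eP v Vv); exact: pV pvx.
Qed.

(** * Uniform limits along a geometric series *)

Lemma half_expn_lt (R : realType) (e : R) :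
  0 < e -> exists n, 2^-1 ^+ n < e.
Proof.
move=> e0.
have [N _ /(_ N (leqnn N))] := near_infty_natSinv_expn_lt (PosNum e0).
by rewrite /= mul1r -exprVn => ?; exists N.
Qed.

(** The sharper bound [2 * 2^-n - 2 * 2^-(n + k)] is what passes through the
    induction on [k]. *)
Lemma half_expn_cauchy (R : realType) (S : Type) (d : S -> S -> R)
    (u : nat -> S) :
    is_metric d -> (forall n, d (u n) (u n.+1) <= 2^-1 ^+ n) ->
  forall n k, d (u n) (u (n + k)%N) <= 2 * 2^-1 ^+ n.
Proof.
move=> [d_ge0 d_eq0 d_sym d_tri] du n k.
suff : d (u n) (u (n + k)%N) <= 2 * 2^-1 ^+ n - 2 * 2^-1 ^+ (n + k).
  move=> /le_trans; apply; rewrite lerBlDr lerDl mulr_ge0// exprn_ge0//.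
elim: k => [|k IHk].
  by rewrite addn0 subrr (d_eq0 (u n) (u n)).2.
apply: (le_trans (d_tri _ (u (n + k)%N) _)).
rewrite addnS exprS; have := du (n + k)%N; lra.
Qed.

Lemma uniform_limit (R : realType) (X : topologicalType) (E : topologicalType)
    (d : E -> E -> R) (u : nat -> X -> E) :
    is_metric d -> generates_topology d -> complete_metric d ->
    (forall n, continuous (u n)) ->
    (forall n x, d (u n x) (u n.+1 x) <= 2^-1 ^+ n) ->
  exists2 h : X -> E, continuous h &
    forall n x, d (u n x) (h x) <= 2 * 2^-1 ^+ n.
Proof.
move=> dM dtop dC ucont du.
have uC x := half_expn_cauchy dM (fun n => du n x).
have [d_ge0 d_eq0 d_sym d_tri] := dM.
have small (e : R) : 0 < e -> exists n, 2 * 2^-1 ^+ n < e.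
  move=> e0; have [|n nP] := @half_expn_lt R (e / 2); first lra.
  by exists n; lra.
have /choice[h hP] : forall x, exists l, forall e : R, 0 < e ->
    exists N : nat, forall n, (N <= n)%N -> d (u n x) l < e.
  move=> x; apply: dC => e e0.
  have [|N NP] := small (e / 2); first lra.
  exists N => m n Nm Nn; apply: le_lt_trans (d_tri _ (u N x) _) _.
  have := uC x N (m - N)%N; have := uC x N (n - N)%N.
  rewrite !subnKC// (d_sym _ (u m x)); lra.
have uh n x : d (u n x) (h x) <= 2 * 2^-1 ^+ n.
  apply/ler_addgt0Pr => e e0; have [N NP] := hP x e e0.
  apply: le_trans (d_tri _ (u (n + N)%N x) _) _.
  have := uC x n N; have := NP (n + N)%N (leq_addl _ _); lra.
exists h => // x U /dtop[e e0 eU].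
have [|n nP] := small (e / 3); first lra.
have ux : nbhs x [set y | d (u n x) (u n y) < e / 3].
  apply: (ucont n x [set y | d (u n x) y < e / 3]).
  by apply/dtop; exists (e / 3) => //; lra.
apply: filterS ux => y /= uxy; apply: eU.
apply: le_lt_trans (d_tri _ (u n x) _) _.
apply: le_lt_trans (lerD (lexx _) (d_tri _ (u n y) _)) _.
have := uh n x; have := uh n y; rewrite (d_sym (h x)); lra.
Qed.

(** * Extending maps into Fréchet spaces *)

Lemma open_relative_preimage (X Y : topologicalType) (A : set X) (W : set Y)
    (g : X -> Y) :
    closed A -> {within A, continuous g} -> open W ->
  open [set x | A x -> W (g x)].
Proof.
move=> clA /subspace_continuousP gcont oW; rewrite openE => x /= AW.
have [Ax|nAx] := pselect (A x).
  by apply: (gcont x Ax W); apply: open_nbhs_nbhs; split => //; exact: AW.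
have : nbhs x (~` A).
  by apply: open_nbhs_nbhs; split => //; exact: closed_openC.
by apply: filterS => y nAy /nAy.
Qed.

Lemma convex_nbhs0 (R : realType) (E : tvsType R) (U : set E) : nbhs 0 U ->
  exists V : set E, [/\ open V, convex_set (V : set (convex_lmodType E)), V 0
    & V `<=` U].
Proof.
have [B Bcvx [Bopen Bbasis]] := @locally_convex R E.
move=> /(Bbasis 0)[V [BV V0] VU]; exists V; split => //; first exact: Bopen.
by apply: Bcvx; rewrite inE.
Qed.

(** One step of the Tietze-type iteration.  For [x] in [A] the set
    [V `&` (g x - W)] is open and contains [g x], and for [x] outside [A] the
    only constraint is to lie in [V]; so the dense set meets every value. *)
Lemma approximate_extension (R : realType) (T : Type) (X : topologicalType)
    (E : tvsType R) (A : set X) (V W : set E) (g : X -> E) :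
    normal_space X -> tau_paracompact T X -> density_le E T ->
    closed A -> {within A, continuous g} ->
    open V -> convex_set (V : set (convex_lmodType E)) -> V !=set0 ->
    open W -> convex_set (W : set (convex_lmodType E)) -> W 0 ->
    (forall x, A x -> V (g x)) ->
  exists f : X -> E, [/\ continuous f, forall x, V (f x)
    & forall x, A x -> W (g x - f x)].
Proof.
move=> normX paraX [D denseD cardD] clA gcont oV cvxV V_neq0 oW cvxW W0 gV.
pose Phi := [set z : X * E | V z.2 /\ (A z.1 -> W (g z.1 - z.2))].
have subcont (e : E) : continuous (fun v : E => v - e).
  by move=> v; apply: tvs_cvgD; [exact: cvg_id|exact: cvg_cst].
have subcont' (e : E) : continuous (fun v : E => e - v).
  move=> v; apply: tvs_cvgD; [exact: cvg_cst|exact: opp_continuous].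
have [|||f fcont fPhi] := @open_fiber_selection R T X E D Phi normX paraX cardD.
- move=> x; apply/convex_setP => t y z t01; rewrite /xsection /= !inE /=.
  move=> [Vy Wy] [Vz Wz]; split; first by move/convex_setP: cvxV; apply.
  move=> Ax; have -> : g x - (t *: y + (1 - t) *: z) =
      t *: (g x - y) + (1 - t) *: (g x - z).
    rewrite !scalerBr addrACA -scalerDl [t + _]addrC subrK scale1r.
    by rewrite opprD.
  by move/convex_setP: cvxW; apply => //; [exact: Wy|exact: Wz].
- move=> e De; have [Ve|nVe] := pselect (V e); last first.
    rewrite (_ : [set _ | _] = set0); first exact: open0.
    by apply/seteqP; split => // x [].
  rewrite (_ : [set _ | _] = [set x | A x -> [set v | W (v - e)] (g x)]).
    apply: open_relative_preimage => //.
    by move/continuousP : (subcont e); apply.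
  by apply/seteqP; split => [x [] //|x Wx]; split.
- move=> x; have [Ax|nAx] := pselect (A x).
    have [||e [[Ve We] De]] := denseD (V `&` [set v | W (g x - v)]).
    + by exists (g x); split; [exact: gV|rewrite /= subrr].
    + by apply: openI => //; move/continuousP : (subcont' (g x)); apply.
    + by exists e.
  have [e [Ve De]] := denseD V V_neq0 oV.
  by exists e.
exists f; have {}fPhi x : Phi (x, f x).
  by have := fPhi x I; rewrite /xsection /= inE.
by split => // x; have [] := fPhi x.
Qed.

(** The approximations [u n] satisfy [g - u n \in V n] on [A], where [V n] lies
    in the ball of radius [2^-n].  Each correction [u n.+1 - u n] approximates
    the error [g - u n] while staying in [V n] on the whole of [X]: this makes
    the sequence uniformly Cauchy on [X], not just on [A]. *)
Lemma frechet_extension (R : realType) (T : Type) (X : topologicalType)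
    (E : tvsType R) (A : set X) (g : X -> E) :
    normal_space X -> tau_paracompact T X -> frechet_space E ->
    density_le E T -> closed A -> {within A, continuous g} ->
  exists2 h : X -> E, continuous h & forall x, A x -> h x = g x.
Proof.
move=> normX paraX [d [dM dtop dC dinv]] densE clA gcont.
have [d_ge0 d_eq0 d_sym d_tri] := dM.
have dB x y : d x y = d 0 (y - x) by rewrite -(dinv 0 (y - x) x) add0r subrK.
have /choice[V VP] : forall n : nat, exists V : set E, [/\ open V,
    convex_set (V : set (convex_lmodType E)), V 0
    & forall v, V v -> d 0 v < 2^-1 ^+ n].
  move=> n; apply: (@convex_nbhs0 _ _ [set v | d 0 v < 2^-1 ^+ n]).
  by apply/dtop; exists (2^-1 ^+ n) => //; rewrite exprn_gt0.
pose approx n (u : X -> E) :=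
  continuous u /\ forall x, A x -> V n (g x - u x).
have [u0 u0P] : exists u, approx 0%N u.
  have [oV0 cvxV0 V00 _] := VP 0%N.
  (* The initial approximation has no error bound to respect: its values range
     over all of [E]. *)
  have cvxT : convex_set ([set: E] : set (convex_lmodType E)).
    by apply/convex_setP.
  have [|f [fcont _ fA]] := approximate_extension normX paraX densE clA gcont
    openT cvxT _ oV0 cvxV0 V00 (fun _ _ => Logic.I); first by exists 0.
  by exists f.
have /choice[next nextP] : forall nu : nat * (X -> E), exists u',
    approx nu.1 nu.2 ->
    approx nu.1.+1 u' /\ forall x, V nu.1 (u' x - nu.2 x).
  move=> [n u]; have [[/= ucont uA]|nu] := pselect (approx n u); last first.
    by exists u.
  have [oV cvxV V0 _] := VP n; have [oV' cvxV' V'0 _] := VP n.+1.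
  have gucont : {within A, continuous (fun x => g x - u x)}.
    move/subspace_continuousP : gcont => gcont; apply/subspace_continuousP.
    move=> x Ax; apply: tvs_cvgD; first exact: gcont.
    apply: cvg_within_filter.
    by apply: continuous_comp; [exact: ucont|exact: opp_continuous].
  have [|f [fcont fV fA]] := approximate_extension normX paraX densE clA gucont
    oV cvxV _ oV' cvxV' V'0 uA; first by exists 0.
  exists (fun x => u x + f x) => _; split; last first.
    by move=> x /=; rewrite [u x + _]addrC addrK.
  split; first by move=> x; apply: tvs_cvgD; [exact: ucont|exact: fcont].
  by move=> x /fA; rewrite /= opprD addrA.
pose u := fix u n := if n is n'.+1 then next (n', u n') else u0.
have uP n : approx n (u n).
  by elim: n => [//|n IHn]; have [] := nextP (n, u n) IHn.
have du n x : d (u n x) (u n.+1 x) <= 2^-1 ^+ n.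
  have [_ /(_ x) uV] := nextP (n, u n) (uP n).
  by have [_ _ _ Vd] := VP n; rewrite dB; apply: ltW; exact: Vd.
have [|h hcont uh] := uniform_limit dM dtop dC _ du.
  by move=> n; have [] := uP n.
exists h => // x Ax; apply/d_eq0/eqP; rewrite eq_le d_ge0 andbT.
apply/ler_addgt0Pr => e e0; rewrite add0r.
have [|n nP] := @half_expn_lt R (e / 3); first lra.
have [_ /(_ x Ax) gu] := uP n; have [_ _ _ /(_ _ gu)] := VP n.
rewrite -dB => ug.
apply: (le_trans (d_tri _ (u n x) _)); rewrite (d_sym (h x)).
have := uh n x; lra.
Qed.

(** * Selections extending a given partial selection *)

Theorem corollary3p5 (R : realType) (T : Type) (infT : infinite_set [set: T])
    (X : topologicalType) (hausX : hausdorff_space X) (normX : normal_space X)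
    (paraX : tau_paracompact T X)
    (A : set X) (clA : closed A)
    (E : tvsType R) (frE : frechet_space E) (densE : density_le E T)
    (Phi : set (X * E)) (Phi0 : nonempty_valued Phi)
    (cvxPhi : convex_valued Phi) (oPhi : open Phi)
    (g : X -> E) (gcont : {within A, continuous g})
    (gsel : selection_on Phi A g) :
  exists f : X -> E,
    [/\ continuous f, selection Phi f & forall x, A x -> f x = g x].
Proof.
have [h hcont hg] := frechet_extension normX paraX frE densE clA gcont.
have openPhi (Y : topologicalType) (k : Y -> X * E) :
    continuous k -> open [set y | Phi (k y)].
  by move=> /continuousP; apply.
have [f1 f1cont f1Phi] : exists2 f : X -> E, continuous f & selection Phi f.
  have [D denseD cardD] := densE.
  apply: (open_fiber_selection normX paraX cardD cvxPhi) => [e _|x].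
    apply: openPhi => x.
    by apply: cvg_pair; [exact: cvg_id|exact: cvg_cst].
  have [||e [Phie De]] := denseD [set e | Phi (x, e)].
  - by have [e] := Phi0 x; rewrite /xsection /= inE; exists e.
  - apply: openPhi => e.
    by apply: cvg_pair; [exact: cvg_cst|exact: cvg_id].
  - by exists e.
have [||l [lcont l01 l1 l0]] :=
    @Urysohn_function R X A [set x | Phi (x, h x)] normX clA.
- apply: openPhi => x.
  by apply: cvg_pair; [exact: cvg_id|exact: hcont].
- by move=> x Ax; have := gsel x Ax; rewrite /xsection /= inE hg.
exists (fun x => l x *: h x + (1 - l x) *: f1 x); split.
- move=> x; apply: tvs_cvgD; apply: tvs_cvgZ; [exact: lcont|exact: hcont| |].
    by apply: cvgB; [exact: cvg_cst|exact: lcont].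
  exact: f1cont.
- move=> x _; have [lx0|/l0 Phih] := eqVneq (l x) 0.
    by rewrite lx0 scale0r add0r subr0 scale1r; exact: f1Phi.
  have /convex_setP := cvxPhi x; apply => //; last exact: f1Phi.
  by rewrite /xsection /= inE.
- by move=> x Ax; rewrite l1// scale1r subrr scale0r addr0 hg.
Qed.
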